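(* Let $\Psi=\{\psi_i\}_{i=1}^{N_1}$ and $\Phi=\{\phi_j\}_{j=1}^{N_2}$ be finite dictionaries of functions in $L^2(\Omega;\mathbb{R})$, and suppose that $\psi_1,\dots,\psi_{N_1}$ are linearly independent in $L^2(\Omega;\mathbb{R})$ and that $\phi_1,\dots,\phi_{N_2}$ are linearly independent in $L^2(\Omega;\mathbb{R})$. Suppose that the snapshots $\{\mathbf{x}_m\}_{m=1}^M$ and the weights $W$ define, as $M\to\infty$, a convergent quadrature rule for the inner products $\langle\psi_i,\psi_j\rangle$, $\langle\phi_i,\phi_j\rangle$ and $\langle\psi_i,\mathcal{K}\phi_j\rangle$ (for all relevant indices). Let $K\in\mathbb{R}^{N_1\times N_2}$ be the least-squares solution of $$\min_{K\in\mathbb{R}^{N_1\times N_2}}\big\|\sqrt{W}\,\Psi(\mathbf{X})K-\sqrt{W}\,\Phi(\mathbf{Y})\big\|_F^2,$$ and set $$G_\Psi=\Psi(\mathbf{X})^\top W\,\Psi(\mathbf{X}),\qquad G_\Phi=\Phi(\mathbf{X})^\top W\,\Phi(\mathbf{X}),\qquad A=\Psi(\mathbf{X})^\top W\,\Phi(\mathbf{Y}).$$ Then $$\lim_{M\to\infty}\mathcal{P}_\Psi^*K=\Pi_\Psi\,\mathcal{K}\,\mathcal{P}_\Phi^*$$ as operators $\mathbb{R}^{N_2}\to L^2(\Omega;\mathbb{R})$, and $$\lim_{M\to\infty}\mathcal{P}_\Psi^*\,G_\Psi^{-1}A\,G_\Phi^{-1}\,\mathcal{P}_\Phi=\Pi_\Psi\,\mathcal{K}\,\Pi_\Phi$$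 as operators on $L^2(\Omega;\mathbb{R})$, both limits being taken in operator norm.
   Context: Dynamics: $\Omega\subset\mathbb{R}^d$ and $F:\Omega\to\Omega$ is a (generally nonlinear) map. $L^2(\Omega;\mathbb{R})$ is taken with respect to Lebesgue measure $m$, with real inner product $\langle f,g\rangle=\int_\Omega fg\,dm$. The Koopman operator is $\mathcal{K}:L^2(\Omega;\mathbb{R})\to L^2(\Omega;\mathbb{R})$, $\mathcal{K}g=g\circ F$; $F$ is assumed to be such that this is a well-defined bounded linear operator. Data: for each $M$ there are snapshots $\mathbf{x}_1,\dots,\mathbf{x}_M\in\Omega$ and a diagonal matrix $W\in\mathbb{R}^{M\times M}$ with positive diagonal entries $w_1,\dots,w_M$ (points and weights may depend on $M$). Dictionary functions are evaluated pointwise (fixed representatives). For a dictionary $\Psi=\{\psi_i\}_{i=1}^{N_1}$, $\Psi(\mathbf{X})\in\mathbb{R}^{M\times N_1}$ is the matrix with entries $[\Psi(\mathbf{X})]_{m,i}=\psi_i(\mathbf{x}_m)$; similarly $[\Phi(\mathbf{X})]_{m,j}=\phi_j(\mathbf{x}_m)$ and $[\Phi(\mathbf{Y})]_{m,j}=\phi_j(F(\mathbf{x}_m))$, with both matrices in $\mathbb{R}^{M\times N_2}$. Convergent quadrature means that for each of the listed inner products $\langle f,g\rangle$ one has $\sum_{m=1}^M w_m f(\mathbf{x}_m)g(\mathbf{x}_m)\to\langle f,g\rangle$ as $M\to\infty$, where $(\mathcal{K}\phi_j)(\mathbf{x}_m)=\phi_j(F(\mathbf{x}_m))$. Standing assumption: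 $\Psi(\mathbf{X})$ has full column rank for all sufficiently large $M$. For such $M$ the least-squares solution is $K=G_\Psi^{-1}A$. The inverses in the claim are considered for $M$ large enough that they exist. Analysis and synthesis maps: $\mathcal{P}_\Psi:L^2(\Omega;\mathbb{R})\to\mathbb{R}^{N_1}$, $\mathcal{P}_\Psi g=(\langle\psi_1,g\rangle,\dots,\langle\psi_{N_1},g\rangle)^\top$, and $\mathcal{P}_\Psi^*:\mathbb{R}^{N_1}\to L^2(\Omega;\mathbb{R})$, $\mathcal{P}_\Psi^*c=\sum_{\ell=1}^{N_1}c_\ell\psi_\ell$; analogously $\mathcal{P}_\Phi,\mathcal{P}_\Phi^*$ for $\Phi$. For a linearly independent dictionary, $\Pi_\Psi=\mathcal{P}_\Psi^*(\mathcal{P}_\Psi\mathcal{P}_\Psi^* )^{-1}\mathcal{P}_\Psi$ is the orthogonal projection of $L^2(\Omega;\mathbb{R})$ onto $\mathrm{span}\{\psi_1,\dots,\psi_{N_1}\}$; analogously $\Pi_\Phi$. *)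

(* Defs.v *)
From HB Require Import structures.
From mathcomp Require Import all_boot all_order all_algebra.
From mathcomp Require Import all_classical all_reals all_analysis.

Set Implicit Arguments.
Unset Strict Implicit.
Unset Printing Implicit Defensive.

Import Order.TTheory GRing.Theory Num.Theory.
Import numFieldNormedType.Exports.

Local Open Scope classical_set_scope.
Local Open Scope ring_scope.

Section borel_lebesgue_step.
Variables (R : realType) (n : nat) (mu : {measure set (n.-tuple R) -> \bar R}).

Definition cons_pair (p : n.-tuple R * R) : n.+1.-tuple R :=
  [tuple of p.2 :: p.1].

Lemma measurable_cons_pair : measurable_fun [set: n.-tuple R * R] cons_pair.
Proof. exact: measurable_cons. Qed.

Definition borel_lebesgue_step : set (n.+1.-tuple R) -> \bar R :=
  pushforward (mu \x lebesgue_measure)%E cons_pair.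

Let step0 : borel_lebesgue_step set0 = 0%E.
Proof. by rewrite /borel_lebesgue_step /pushforward preimage_set0 measure0. Qed.

Let step_ge0 A : (0 <= borel_lebesgue_step A)%E.
Proof. by rewrite /borel_lebesgue_step /pushforward. Qed.

Let measurable_step (A : set (n.+1.-tuple R)) :
  measurable A -> measurable (cons_pair @^-1` A).
Proof.
by move=> mA; rewrite -[X in measurable X]setTI; exact: measurable_cons_pair.
Qed.

Let step_sigma_additive : semi_sigma_additive borel_lebesgue_step.
Proof.
move=> F mF tF mUF; rewrite /borel_lebesgue_step /pushforward preimage_bigcup.
apply: measure_semi_sigma_additive.
- by move=> i; exact: measurable_step.
- apply/trivIsetP => i j _ _ ij; move/trivIsetP: tF => /(_ i j I I ij) Fij.
  by rewrite -preimage_setI Fij preimage_set0.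
- by rewrite -preimage_bigcup; exact: measurable_step.
Qed.

HB.instance Definition _ := isMeasure.Build _ _ _ borel_lebesgue_step
  step0 step_ge0 step_sigma_additive.

End borel_lebesgue_step.

(* The n-fold product of one-dimensional Lebesgue measure, on the Borel sets of
   R^n. *)
Fixpoint borel_lebesgue (R : realType) n : {measure set (n.-tuple R) -> \bar R} :=
  match n with
  | 0 => \d_([tuple] : 0.-tuple R)
  | n'.+1 => borel_lebesgue_step (borel_lebesgue R n')
  end.

(* On boxes the measure is the product of the side lengths. *)
Lemma borel_lebesgue_box (R : realType) n (B : 'I_n -> set R) :
  (forall i, measurable (B i)) ->
  borel_lebesgue R n [set x | forall i, B i (tnth x i)] = (\prod_i lebesgue_measure (B i))%E.
Proof.
elim: n B => [|n IH] B mB /=.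
  rewrite big_ord0 diracE mem_set// => -[]//.
rewrite big_ord_recl /borel_lebesgue_step /pushforward.
rewrite (_ : _ @^-1` _ = [set x | forall i, B (lift ord0 i) (tnth x i)] `*` B ord0); last first.
  apply/seteqP; split=> [[x y]/= h|[x y]/= [h1 h2] i].
    split=> [i|]; last exact: (h ord0).
    by have := h (lift ord0 i); rewrite tnthS.
  by case: (unliftP ord0 i) => [j ->|->//]; rewrite tnthS.
have mC : measurable [set x : n.-tuple R | forall i, B (lift ord0 i) (tnth x i)].
  have -> : [set x : n.-tuple R | forall i, B (lift ord0 i) (tnth x i)] =
    \bigcap_(i in [set: 'I_n]) [set x | B (lift ord0 i) (tnth x i)].
    by apply/seteqP; split=> [x /= h i _|x /= h i]; [exact: h|exact: h i I].
  apply: fin_bigcap_measurable => [|i _]; first exact: finite_finset.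
  rewrite -[X in measurable X]setTI.
  exact: (measurable_tnth (T := measurableTypeR R) i measurableT (mB _)).
rewrite product_measure1E//.
rewrite muleC; congr (_ * _)%E.
by apply: (IH (fun i => B (lift ord0 i))) => i; exact: mB.
exact: (mB ord0).
Qed.

(* R^n with the sigma-algebra of the Lebesgue (not only Borel) measurable sets:
   the Caratheodory construction from the outer measure of borel_lebesgue. *)
Definition euclidean (R : realType) n : measurableType _ :=
  caratheodory_type ((borel_lebesgue R n)^*)%mu.

Definition lebesgue (R : realType) n : {measure set (euclidean R n) -> \bar R} :=
  @completed_measure_extension _ _ _ (borel_lebesgue R n).

(* A nonempty measurable subset, as a measure space with the trace
   sigma-algebra and the restricted measure. *)
Section subspace.
Context d (T : measurableType d) (R : realType).
Variables (mu : {measure set T -> \bar R}) (D : set T).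
Variables (mD : measurable D) (D0 : D !=set0).

Definition msubspace of measurable D & D !=set0 : Type := set_type D.

Local Notation S := (msubspace mD D0).

Definition msubspace_val (x : S) : T := set_val x.

HB.instance Definition _ := gen_eqMixin S.
HB.instance Definition _ := gen_choiceMixin S.
HB.instance Definition _ := isPointed.Build S
  (exist _ (projT1 (cid D0)) (mem_set (projT2 (cid D0)))).

Definition msubspace_measurable : set (set S) :=
  [set A | measurable (msubspace_val @` A)].

Lemma msubspace_val_inj : injective msubspace_val.
Proof. exact: val_inj. Qed.

Let measurable_set0 : msubspace_measurable set0.
Proof. by rewrite /msubspace_measurable/= image_set0. Qed.

Let measurableC A : msubspace_measurable A -> msubspace_measurable (~` A).
Proof.
rewrite /msubspace_measurable/= => mA.
suff -> : msubspace_val @` (~` A) = D `\` msubspace_val @` A.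
  exact: measurableD.
apply/seteqP; split=> [_ [x nAx <-]|x [Dx nAx]].
  by split; [exact: set_valP|move=> [y Ay] /msubspace_val_inj yx; apply: nAx; rewrite -yx].
by exists (exist _ x (mem_set Dx)) => // Ax; apply: nAx; exists (exist _ x (mem_set Dx)).
Qed.

Let measurable_bigcup (F : (set S)^nat) :
  (forall i, msubspace_measurable (F i)) -> msubspace_measurable (\bigcup_i F i).
Proof.
by rewrite /msubspace_measurable/= image_bigcup => mF; exact: bigcup_measurable.
Qed.

HB.instance Definition _ := @isMeasurable.Build d S msubspace_measurable
  measurable_set0 measurableC measurable_bigcup.

Definition msubspace_measure (A : set S) : \bar R := mu (msubspace_val @` A).

Let measure_set0 : msubspace_measure set0 = 0%E.
Proof. by rewrite /msubspace_measure image_set0 measure0. Qed.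

Let measure_pos A : (0 <= msubspace_measure A)%E.
Proof. by rewrite /msubspace_measure. Qed.

Let measure_additive : semi_sigma_additive msubspace_measure.
Proof.
move=> F mF tF mUF; rewrite /msubspace_measure image_bigcup.
apply: measure_semi_sigma_additive => //; last by rewrite -image_bigcup.
apply/trivIsetP => i j _ _ ij; apply/seteqP; split=> // _ [[x Fx <-] [y Fy]].
move=> /msubspace_val_inj yx; move/trivIsetP: tF => /(_ i j I I ij) Fij.
have : (F i `&` F j) x by split; [exact: Fx|rewrite -yx].
by rewrite Fij.
Qed.

HB.instance Definition _ := isMeasure.Build _ _ _ msubspace_measure
  measure_set0 measure_pos measure_additive.

End subspace.
Arguments msubspace_measure {d T R} mu {D} mD D0.

Definition lebesgue_on (R : realType) n (Omega : set (euclidean R n))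
    (mOmega : measurable Omega) (Omega0 : Omega !=set0) :
    {measure set (msubspace mOmega Omega0) -> \bar R} :=
  msubspace_measure (lebesgue R n) mOmega Omega0.

(* L^2 is handled through representatives: an element of [L2 mu] is an actual
   square-integrable function, and equality in L^2 is equality mu-almost
   everywhere. *)
Notation L2 mu := (LfunType mu (lee1n 2)).

Section L2.
Context d (T : measurableType d) (R : realType).
Variable mu : {measure set T -> \bar R}.

Definition inner (f g : L2 mu) : R := \int[mu]_x (f x * g x).

Definition L2norm (f : L2 mu) : R := fine ('N[mu]_(2%:R%:E)[EFin \o f])%E.

Definition analysis N (Psi : 'I_N -> L2 mu) (g : L2 mu) : 'cV[R]_N :=
  \col_l inner (Psi l) g.

Definition synthesis N (Psi : 'I_N -> L2 mu) (c : 'cV[R]_N) : L2 mu :=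
  \sum_l c l 0 *: Psi l.

Definition lin_indep N (Psi : 'I_N -> L2 mu) : Prop :=
  forall c : 'cV[R]_N, synthesis Psi c = 0 %[ae mu] -> c = 0.

(* the matrix of the linear map analysis Psi \o synthesis Psi *)
Definition gram N (Psi : 'I_N -> L2 mu) : 'M[R]_N :=
  \matrix_(i, j) analysis Psi (synthesis Psi (delta_mx j 0)) i 0.

Definition proj_span N (Psi : 'I_N -> L2 mu) (g : L2 mu) : L2 mu :=
  synthesis Psi (invmx (gram Psi) *m analysis Psi g).

Record koopman_bounded (F : T -> T) : Prop := KoopmanBounded {
  koopman_L2 : forall g : L2 mu, g \o F \in Lfun mu 2%:R%:E ;
  koopman_ae : forall g h : L2 mu,
    g = h %[ae mu] -> g \o F = h \o F %[ae mu] ;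
  koopman_bound : exists C : R, forall g : L2 mu,
    L2norm (Lfun_Sub (lee1n 2) (koopman_L2 g)) <= C * L2norm g }.

Definition koopman (F : T -> T) (hF : koopman_bounded F) (g : L2 mu) : L2 mu :=
  Lfun_Sub (lee1n 2) (koopman_L2 hF g).

End L2.

Definition euclidean_norm (R : realType) N (c : 'cV[R]_N) : R :=
  Num.sqrt (\sum_i c i 0 ^+ 2).

Definition frobenius_norm (R : realType) m n (A : 'M[R]_(m, n)) : R :=
  Num.sqrt (\sum_i \sum_j A i j ^+ 2).

(* Extended-real valued, so that an unbounded map has norm +oo. *)
Definition operator_norm (R : realType) (U V : Type) (normU : U -> R)
    (normV : V -> R) (A : U -> V) : \bar R :=
  ereal_sup [set (normV (A u))%:E | u in [set u | normU u <= 1]].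

Section data.
Context (T : Type) (R : realType).

(* [Psi(X)]_{m,i} = psi_i(x_m); [Phi(Y)] is [data_matrix Phi (F \o x)]. *)
Definition data_matrix M N (Psi : 'I_N -> T -> R) (x : 'I_M -> T) : 'M[R]_(M, N) :=
  \matrix_(m, i) Psi i (x m).

Definition quadrature M (x : 'I_M -> T) (w : 'rV[R]_M) (f g : T -> R) : R :=
  \sum_m w 0 m * f (x m) * g (x m).

(* K minimises || sqrt(W) PX K - sqrt(W) PY ||_F^2 with W = diag w. *)
Definition least_squares M N1 N2 (w : 'rV[R]_M) (PX : 'M[R]_(M, N1))
    (PY : 'M[R]_(M, N2)) (K : 'M[R]_(N1, N2)) : Prop :=
  let sqrtW := diag_mx (map_mx Num.sqrt w) in
  let objective (K' : 'M[R]_(N1, N2)) :=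
    frobenius_norm (sqrtW *m PX *m K' - sqrtW *m PY) ^+ 2 in
  forall K' : 'M[R]_(N1, N2), objective K <= objective K'.

End data.

(* Main.v *)
Require Import Defs.
From HB Require Import structures.
From mathcomp Require Import all_boot all_order all_algebra.
From mathcomp Require Import all_classical all_reals all_analysis.
Import Order.TTheory GRing.Theory Num.Theory.
Import numFieldNormedType.Exports.

Local Open Scope classical_set_scope.
Local Open Scope ring_scope.

(** The operators on both sides are determined by a matrix between coefficient
    spaces.  Let U be the Koopman operator, A0 i j = <psi_i, U phi_j> and
    gram Psi i j = <psi_i, psi_j>.  Since U is linear,
    Pi_Psi U P_Phi^* = P_Psi^* (gram Psi)^-1 A0 and
    Pi_Psi U Pi_Phi = P_Psi^* (gram Psi)^-1 A0 (gram Phi)^-1 P_Phi.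
    Both claims therefore compare operators of the form P_Psi^* B a, with the
    same bounded map a into coefficient vectors (the identity, or P_Phi) and two
    different matrices B.  Such operators depend continuously on B
    ([operator_norm_synthesis_cvg0]), so only entrywise convergence of finite
    matrices is left.

    The entries of G_Psi, G_Phi and A are quadrature sums, hence converge to
    those of gram Psi, gram Phi and A0.  A linearly independent dictionary has
    an invertible Gram matrix ([gram_unit]), because a kernel vector v gives a
    function sum_l v_l psi_l of zero L^2 norm.  Matrix inversion is continuous
    at an invertible matrix ([mx_cvg_inv], from Cramer's formula), so
    G_Psi^-1 A and G_Psi^-1 A G_Phi^-1 converge to the expected limits.
    Finally, as soon as G_Psi is invertible the least-squares minimiser is
    unique and equal to G_Psi^-1 A ([least_squares_solution]), by Pythagoras. *)

(** * The inner product of L^2 and Gram matrices *)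

Section L2_inner_product.
Set Implicit Arguments.
Unset Strict Implicit.
Context d (T : measurableType d) (R : realType).
Context (mu : {measure set T -> \bar R}).
Implicit Types f g h : L2 mu.

Lemma integrable_mul_L2 f g : mu.-integrable [set: T] (EFin \o (f \* g)).
Proof. by apply/Lfun1_integrable/Lfun2_mul_Lfun1; exact: LfunP. Qed.

Lemma innerC f g : inner f g = inner g f.
Proof. by apply: eq_Rintegral => x _; rewrite mulrC. Qed.

Lemma innerDr f : {morph inner f : g h / g + h}.
Proof.
move=> g h.
have -> : inner f (g + h) = \int[mu]_x (f x * g x + f x * h x).
  by apply: eq_Rintegral => x _; rewrite -mulrDr.
by rewrite RintegralD//; [exact: (integrable_mul_L2 f g)|
                          exact: (integrable_mul_L2 f h)].
Qed.

Lemma innerZr f (a : R) g : inner f (a *: g) = a * inner f g.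
Proof.
rewrite -RintegralZl//; last exact: (integrable_mul_L2 f g).
by apply: eq_Rintegral => x _; rewrite mulrCA.
Qed.

Lemma inner0r f : inner f 0 = 0.
Proof. by rewrite -(scale0r (0 : L2 mu)) innerZr mul0r. Qed.

(** Hoelder's inequality with both exponents equal to 2. *)
Lemma inner_cauchy_schwarz f g : `|inner f g| <= L2norm f * L2norm g.
Proof.
have fg1 := integrable_mul_L2 f g.
rewrite -lee_fin EFinM /L2norm !finite_norm_fine.
have half2 : (2^-1 + 2^-1 = 1 :> R) by rewrite [RHS]splitr !div1r.
have mf : measurable_fun [set: T] f by [].
have mg : measurable_fun [set: T] g by [].
apply: le_trans (hoelder mu mf mg (ltr0n _ 2) (ltr0n _ 2) half2).
rewrite Lnorm1 EFin_normr_Rintegral//.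
by apply: le_abse_integral => //; exact: measurable_int fg1.
Qed.

Lemma L2norm_ge0 f : 0 <= L2norm f.
Proof. exact/fine_ge0/Lnorm_ge0. Qed.

Lemma L2normZ (a : R) f : L2norm (a *: f) = `|a| * L2norm f.
Proof.
by apply: EFin_inj; rewrite EFinM /L2norm !finite_norm_fine -LnormZ.
Qed.

Lemma L2norm0 : L2norm (0 : L2 mu) = 0.
Proof. by rewrite -(scale0r (0 : L2 mu)) L2normZ normr0 mul0r. Qed.

Lemma inner_eq0 f : inner f f = 0 -> f = 0 %[ae mu].
Proof.
move=> f0; have ff := integrable_mul_L2 f f.
have : (\int[mu]_x `|(f x * f x)%:E| = 0)%E.
  under eq_integral do rewrite gee0_abs ?lee_fin -?expr2 ?sqr_ge0//.
  rewrite -[LHS]fineK//; last first.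
    exact: (integrable_fin_num measurableT (integrable_mul_L2 f f)).
  congr (_%:E); rewrite -[RHS]f0; apply: eq_Rintegral => x _.
  by rewrite expr2.
move/(ae_eq_integral_abs mu measurableT (measurable_int _ ff)).
apply: filterS => x /(_ I) [] /eqP; rewrite mulf_eq0 orbb => /eqP fx _.
exact: fx.
Qed.

Lemma L2norm_sum N (f : 'I_N -> L2 mu) :
  L2norm (\sum_i f i) <= \sum_i L2norm (f i).
Proof.
elim/big_ind2 : _ => [|u a v b ua vb|//]; first by rewrite L2norm0.
exact: le_trans (ler_LnormD _ _) (lerD ua vb).
Qed.

Lemma synthesis_linear N (Psi : 'I_N -> L2 mu) : linear (synthesis Psi).
Proof.
move=> a b c; rewrite /synthesis scaler_sumr -big_split/=.
by apply: eq_bigr => l _; rewrite !mxE scalerDl scalerA.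
Qed.

HB.instance Definition _ N (Psi : 'I_N -> L2 mu) :=
  GRing.isLinear.Build R 'cV[R]_N (L2 mu) _ (synthesis Psi) (synthesis_linear Psi).

Lemma inner_synthesis N (Psi : 'I_N -> L2 mu) f (c : 'cV[R]_N) :
  inner f (synthesis Psi c) = \sum_l c l 0 * inner f (Psi l).
Proof.
rewrite (big_morph _ (innerDr f) (inner0r f)).
by apply: eq_bigr => l _; exact: innerZr.
Qed.

(** The matrix of [analysis Psi \o synthesis Phi]; with [Phi] replaced by its
    image under the Koopman operator it is the limit of the data matrix A. *)
Definition cross_gram N1 N2 (Psi : 'I_N1 -> L2 mu) (Phi : 'I_N2 -> L2 mu) :=
  \matrix_(i, j) inner (Psi i) (Phi j).

Lemma analysis_synthesis N1 N2 (Psi : 'I_N1 -> L2 mu) (Phi : 'I_N2 -> L2 mu)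
    (c : 'cV[R]_N2) :
  analysis Psi (synthesis Phi c) = cross_gram Psi Phi *m c.
Proof.
apply/colP => i; rewrite !mxE inner_synthesis; apply: eq_bigr => l _.
by rewrite mxE mulrC.
Qed.

Lemma gramE N (Psi : 'I_N -> L2 mu) : gram Psi = cross_gram Psi Psi.
Proof.
apply/matrixP => i j; rewrite [LHS]mxE.
by rewrite analysis_synthesis -colE mxE.
Qed.

(** If v is in the left kernel of the Gram matrix, then
    ||sum_l v_l psi_l||^2 = v (gram Psi) v^T = 0, and independence gives v = 0. *)
Lemma gram_unit N (Psi : 'I_N -> L2 mu) : lin_indep Psi -> gram Psi \in unitmx.
Proof.
move=> indep; rewrite -row_free_unit -kermx_eq0; apply/eqP/row_matrixP => i.
rewrite row0; set v := row i _.
suff : v^T = 0 by move=> /(congr1 trmx); rewrite trmxK trmx0.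
apply: indep; apply: inner_eq0.
have vG : v *m gram Psi = 0 by rewrite -row_mul mulmx_ker row0.
transitivity ((v *m analysis Psi (synthesis Psi v^T)) 0 0).
  rewrite inner_synthesis mxE; apply: eq_bigr => l _.
  by rewrite !mxE innerC.
by rewrite analysis_synthesis -gramE mulmxA vG mul0mx mxE.
Qed.

(** Composition with [F] is linear on actual functions, so this equality holds
    between representatives, not merely almost everywhere. *)
Lemma koopman_synthesis F (hF : koopman_bounded mu F) N (Phi : 'I_N -> L2 mu) c :
  koopman hF (synthesis Phi c) = synthesis (fun j => koopman hF (Phi j)) c.
Proof.
have synE (f : 'I_N -> L2 mu) (x : T) :
    synthesis f c x = \sum_l c l 0 * f l x.
  by rewrite /synthesis; apply: (big_morph (fun g : L2 mu => (g : T -> R) x)).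
by apply: val_inj; apply/funext => x; rewrite [LHS]/= synE [RHS]synE.
Qed.

Lemma L2norm_synthesis_le N (Psi : 'I_N -> L2 mu) (c : 'cV[R]_N) :
  L2norm (synthesis Psi c) <= \sum_l `|c l 0| * L2norm (Psi l).
Proof.
by apply: le_trans (L2norm_sum _) _; apply: ler_sum => l _; rewrite L2normZ.
Qed.

End L2_inner_product.

(** * Entrywise convergence of matrices *)

Section entrywise_convergence.
Set Implicit Arguments.
Unset Strict Implicit.
Context (R : realType).

Definition mx_cvg m n (X : nat -> 'M[R]_(m, n)) (Y : 'M[R]_(m, n)) : Prop :=
  forall i j, X M i j @[M --> \oo] --> Y i j.

Lemma cvg_bigsum (I : finType) (u : I -> nat -> R) (l : I -> R) :
  (forall i, u i @ \oo --> l i) ->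
  \sum_i u i M @[M --> \oo] --> \sum_i l i.
Proof. by move=> ul; apply: cvg_big => // x; exact: add_continuous. Qed.

Lemma cvg_bigprod (I : finType) (u : I -> nat -> R) (l : I -> R) :
  (forall i, u i @ \oo --> l i) ->
  \prod_i u i M @[M --> \oo] --> \prod_i l i.
Proof. by move=> ul; apply: cvg_big => // x; exact: mul_continuous. Qed.

Lemma mx_cvg_mul m n p (X : nat -> 'M[R]_(m, n)) (Y : nat -> 'M[R]_(n, p)) X0 Y0 :
  mx_cvg X X0 -> mx_cvg Y Y0 -> mx_cvg (fun M => X M *m Y M) (X0 *m Y0).
Proof.
move=> XX0 YY0 i j; rewrite mxE; under eq_cvg do rewrite mxE.
by apply: cvg_bigsum => k; exact: cvgM.
Qed.

Lemma cvg_det n (X : nat -> 'M[R]_n) X0 :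
  mx_cvg X X0 -> \det (X M) @[M --> \oo] --> \det X0.
Proof.
move=> XX0; apply: cvg_bigsum => s; apply: cvgM; first exact: cvg_cst.
by apply: cvg_bigprod => i; exact: XX0.
Qed.

(** The determinant is a polynomial in the entries, so it stays nonzero near an
    invertible limit. *)
Lemma near_unitmx n (X : nat -> 'M[R]_n) X0 :
  mx_cvg X X0 -> X0 \in unitmx -> \forall M \near \oo, X M \in unitmx.
Proof.
move=> XX0 uX0; have detX0 : \det X0 != 0 by rewrite -unitfE -unitmxE.
near=> M; rewrite unitmxE unitfE; near: M.
exact: cvgr_neq0 (cvg_det XX0) detX0.
Unshelve. all: by end_near.
Qed.

(** By Cramer's formula the inverse is the adjugate, polynomial in the entries,
    divided by the determinant; [invmx] follows this formula only where it
    inverts, hence the restriction to large [M] inside the proof. *)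
Lemma mx_cvg_inv n (X : nat -> 'M[R]_n) X0 :
  mx_cvg X X0 -> X0 \in unitmx -> mx_cvg (fun M => invmx (X M)) (invmx X0).
Proof.
move=> XX0 uX0 i j; have detX0 : \det X0 != 0 by rewrite -unitfE -unitmxE.
have -> : invmx X0 i j = (\det X0)^-1 * \adj X0 i j by rewrite /invmx uX0 mxE.
have adj_cvg : \adj (X M) i j @[M --> \oo] --> \adj X0 i j.
  rewrite mxE /cofactor; under eq_cvg do rewrite mxE /cofactor.
  apply: cvgM; first exact: cvg_cst.
  apply: (cvg_det (X := fun M => row' j (col' i (X M)))) => k l.
  by rewrite !mxE; under eq_cvg do rewrite !mxE; exact: XX0.
apply: cvg_trans (cvgM (cvgV detX0 (cvg_det XX0)) adj_cvg).
apply: near_eq_cvg; near=> M.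
have uX : X M \in unitmx by near: M; exact: near_unitmx XX0 uX0.
by rewrite /invmx uX mxE.
Unshelve. all: by end_near.
Qed.

End entrywise_convergence.

(** * Weighted least squares *)

Section least_squares.
Set Implicit Arguments.
Unset Strict Implicit.
Context (R : realType).

Lemma frobenius_normE m n (A : 'M[R]_(m, n)) :
  frobenius_norm A ^+ 2 = \tr (A^T *m A).
Proof.
rewrite sqr_sqrtr; last first.
  by apply: sumr_ge0 => i _; apply: sumr_ge0 => j _; exact: sqr_ge0.
rewrite exchange_big/=; apply: eq_bigr => j _; rewrite mxE.
by apply: eq_bigr => i _; rewrite mxE expr2.
Qed.

Lemma frobenius_norm_pythagoras m n (E H : 'M[R]_(m, n)) :
  H^T *m E = 0 ->
  frobenius_norm (E + H) ^+ 2 = frobenius_norm E ^+ 2 + frobenius_norm H ^+ 2.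
Proof.
move=> HE; have EH : E^T *m H = 0.
  by rewrite -[LHS]trmxK trmx_mul trmxK HE trmx0.
rewrite !frobenius_normE [(E + H)^T]raddfD/= mulmxDl !mulmxDr EH HE.
by rewrite addr0 add0r mxtraceD.
Qed.

Lemma sqr_frobenius_norm_le0 m n (A : 'M[R]_(m, n)) :
  frobenius_norm A ^+ 2 <= 0 -> A = 0.
Proof.
rewrite sqr_sqrtr; last first.
  by apply: sumr_ge0 => i _; apply: sumr_ge0 => j _; exact: sqr_ge0.
move=> A0; apply/matrixP => i j; rewrite mxE; apply/eqP; rewrite -sqrf_eq0.
rewrite eq_le sqr_ge0 andbT; apply: le_trans A0.
rewrite (bigD1 i)//= (bigD1 j)//= -addrA lerDl addr_ge0//.
  by apply: sumr_ge0 => k _; exact: sqr_ge0.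
by apply: sumr_ge0 => k _; apply: sumr_ge0 => l _; exact: sqr_ge0.
Qed.

(** The candidate K0 = G^-1 P^T W Q solves the normal equations, which say that
    its residual is orthogonal to the range of sqrt(W) P.  By Pythagoras the
    objective at K exceeds the one at K0 by ||sqrt(W) P (K - K0)||^2, which must
    vanish for a minimiser; multiplying by (sqrt(W) P)^T gives G (K - K0) = 0. *)
Lemma least_squares_solution m n p (w : 'rV[R]_m) (P : 'M[R]_(m, n))
    (Q : 'M[R]_(m, p)) (K : 'M[R]_(n, p)) :
  (forall i, 0 <= w 0 i) -> P^T *m diag_mx w *m P \in unitmx ->
  least_squares w P Q K ->
  K = invmx (P^T *m diag_mx w *m P) *m (P^T *m diag_mx w *m Q).
Proof.
move=> w0; set D := diag_mx (map_mx Num.sqrt w).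
have DD : D^T *m D = diag_mx w.
  rewrite tr_diag_mx mulmx_diag; congr diag_mx; apply/rowP => i.
  by rewrite !mxE -expr2 sqr_sqrtr.
rewrite -!DD => uG lsq; set G := _ *m P; set K0 := invmx G *m _.
have Gsol : G *m K0 = P^T *m (D^T *m D) *m Q by rewrite mulKVmx.
have orth : (D *m P)^T *m (D *m P *m K0 - D *m Q) = 0.
  apply/eqP; rewrite mulmxBr subr_eq0; apply/eqP.
  by rewrite trmx_mul -!mulmxA; move: Gsol; rewrite /G -!mulmxA.
have pyth : frobenius_norm (D *m P *m K - D *m Q) ^+ 2 =
    frobenius_norm (D *m P *m K0 - D *m Q) ^+ 2 +
    frobenius_norm (D *m P *m (K - K0)) ^+ 2.
  have -> : D *m P *m K - D *m Q =
      (D *m P *m K0 - D *m Q) + D *m P *m (K - K0).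
    by rewrite mulmxBr addrAC addrCA subrr addr0.
  apply: frobenius_norm_pythagoras.
  by rewrite trmx_mul -[LHS]mulmxA orth mulmx0.
have := lsq K0; rewrite /= -/D pyth gerDl => /sqr_frobenius_norm_le0 DPH.
have GH : G *m (K - K0) = 0.
  by rewrite /G -!mulmxA (mulmxA D) DPH !mulmx0.
by apply/eqP; rewrite -subr_eq0 -(mulKmx uG (K - K0)) GH mulmx0.
Qed.

End least_squares.

(** * Continuity of the synthesised operators in the matrix *)

Section operator_convergence.
Set Implicit Arguments.
Unset Strict Implicit.
Context d (T : measurableType d) (R : realType).
Context (mu : {measure set T -> \bar R}).

(** On the unit ball of [U] the coefficients of [a u] are bounded by [C], so by
    the triangle inequality the operator norm is at most
    sum_i (sum_j |B_M i j - B0 i j| C_j) ||psi_i||, which tends to 0.  The point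
    [u0] makes the unit ball nonempty, so that the supremum is nonnegative and
    not -oo. *)
Lemma operator_norm_synthesis_cvg0 (U : Type) (normU : U -> R) (u0 : U)
    N1 N2 (Psi : 'I_N1 -> L2 mu) (a : U -> 'cV[R]_N2) (C : 'I_N2 -> R)
    (B : nat -> 'M[R]_(N1, N2)) (B0 : 'M[R]_(N1, N2)) :
  normU u0 <= 1 -> (forall u j, normU u <= 1 -> `|a u j 0| <= C j) ->
  mx_cvg B B0 ->
  operator_norm normU (@L2norm _ _ _ mu)
    (fun u => synthesis Psi (B M *m a u) - synthesis Psi (B0 *m a u))
    @[M --> \oo] --> 0%E.
Proof.
move=> u01 aC BB0.
pose e M := \sum_i (\sum_j `|B M i j - B0 i j| * C j) * L2norm (Psi i).
apply: (@squeeze_cvge _ _ _ _ (fun=> 0%E) _ (fun M => (e M)%:E)).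
- apply: nearW => M; apply/andP; split.
    apply: le_trans (ereal_sup_ubound _); last by exists u0.
    by rewrite lee_fin L2norm_ge0.
  apply: ge_ereal_sup => _ [u /= u1 <-]; rewrite lee_fin.
  rewrite -raddfB/= -mulmxBl.
  apply: le_trans (L2norm_synthesis_le _ _) _; apply: ler_sum => i _.
  apply: ler_wpM2r; first exact: L2norm_ge0.
  rewrite mxE; apply: le_trans (ler_norm_sum _ _ _) _.
  apply: ler_sum => j _; rewrite normrM !mxE ler_wpM2l//; exact: aC.
- exact: cvg_cst.
- apply: cvg_EFin; first exact: nearW.
  (* 0 as the value of the bound at B M = B0, so that sums and products converge
     termwise *)
  rewrite (_ : 0 = \sum_i (\sum_j `|B0 i j - B0 i j| * C j) * L2norm (Psi i)).
    apply: cvg_bigsum => i; apply: cvgM; last exact: cvg_cst.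
    apply: cvg_bigsum => j; apply: cvgM; last exact: cvg_cst.
    by apply: cvg_norm; apply: cvgB; [exact: BB0|exact: cvg_cst].
  by rewrite big1// => i _; rewrite big1 ?mul0r// => j _; rewrite subrr normr0 mul0r.
Qed.

Lemma entry_le_euclidean_norm N (c : 'cV[R]_N) j : `|c j 0| <= euclidean_norm c.
Proof.
rewrite -sqrtr_sqr ler_wsqrtr// (bigD1 j)//= lerDl.
by apply: sumr_ge0 => i _; exact: sqr_ge0.
Qed.

End operator_convergence.

(** * Data matrices and the limit theorem *)

Section data.
Set Implicit Arguments.
Unset Strict Implicit.
Context (R : realType) (T S : Type).

Lemma data_matrix_product M N1 N2 (f : 'I_N1 -> T -> R) (g : 'I_N2 -> S -> R)
    (x : 'I_M -> T) (y : 'I_M -> S) (w : 'rV[R]_M) i j :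
  ((data_matrix f x)^T *m diag_mx w *m data_matrix g y) i j =
  \sum_m w 0 m * f i (x m) * g j (y m).
Proof.
rewrite mul_mx_diag mxE; apply: eq_bigr => m _.
by rewrite !mxE (mulrC (f i _)).
Qed.

End data.

Theorem proposition2p1 (R : realType) (d : nat)
    (Omega : set (euclidean R d))
    (mOmega : measurable Omega) (Omega0 : Omega !=set0)
    (F : msubspace mOmega Omega0 -> msubspace mOmega Omega0)
    (hF : koopman_bounded (lebesgue_on mOmega Omega0) F)
    (N1 N2 : nat)
    (Psi : 'I_N1 -> L2 (lebesgue_on mOmega Omega0))
    (Phi : 'I_N2 -> L2 (lebesgue_on mOmega Omega0))
    (Psi_indep : lin_indep Psi) (Phi_indep : lin_indep Phi)
    (x : forall M : nat, 'I_M -> msubspace mOmega Omega0)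
    (w : forall M : nat, 'rV[R]_M)
    (w_gt0 : forall (M : nat) (m : 'I_M), 0 < w M 0 m)
    (quad_Psi : forall i j : 'I_N1,
      quadrature (x M) (w M) (Psi i) (Psi j) @[M --> \oo] -->
        inner (Psi i) (Psi j))
    (quad_Phi : forall i j : 'I_N2,
      quadrature (x M) (w M) (Phi i) (Phi j) @[M --> \oo] -->
        inner (Phi i) (Phi j))
    (quad_koopman : forall (i : 'I_N1) (j : 'I_N2),
      quadrature (x M) (w M) (Psi i) (koopman hF (Phi j)) @[M --> \oo] -->
        inner (Psi i) (koopman hF (Phi j)))
    (full_rank : \forall M \near \oo, \rank (data_matrix Psi (x M)) = N1)
    (K : nat -> 'M[R]_(N1, N2))
    (K_lsq : \forall M \near \oo,
      least_squares (w M) (data_matrix Psi (x M))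
        (data_matrix Phi (F \o x M)) (K M)) :
  let G_Psi M := (data_matrix Psi (x M))^T *m diag_mx (w M) *m
                   data_matrix Psi (x M) in
  let G_Phi M := (data_matrix Phi (x M))^T *m diag_mx (w M) *m
                   data_matrix Phi (x M) in
  let A M := (data_matrix Psi (x M))^T *m diag_mx (w M) *m
               data_matrix Phi (F \o x M) in
  let norm := @L2norm _ _ _ (lebesgue_on mOmega Omega0) in
  (operator_norm (@euclidean_norm R N2) norm
     (fun c => synthesis Psi (K M *m c)
               - proj_span Psi (koopman hF (synthesis Phi c)))
     @[M --> \oo] --> 0%E) /\
  (operator_norm norm norm
     (fun g => synthesis Psi (invmx (G_Psi M) *m A M *m invmx (G_Phi M) *m
                              analysis Phi g)
               - proj_span Psi (koopman hF (proj_span Phi g)))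
     @[M --> \oo] --> 0%E).
Proof.
move=> G_Psi G_Phi A norm.
pose A0 := cross_gram Psi (fun j => koopman hF (Phi j)).
have G_Psi_cvg : mx_cvg G_Psi (gram Psi).
  move=> i j; rewrite gramE mxE; under eq_cvg do rewrite data_matrix_product.
  exact: quad_Psi.
have G_Phi_cvg : mx_cvg G_Phi (gram Phi).
  move=> i j; rewrite gramE mxE; under eq_cvg do rewrite data_matrix_product.
  exact: quad_Phi.
have A_cvg : mx_cvg A A0.
  move=> i j; rewrite mxE; under eq_cvg do rewrite data_matrix_product.
  exact: quad_koopman.
have uPsi := gram_unit Psi_indep.
have uPhi := gram_unit Phi_indep.
have edmd_cvg : mx_cvg (fun M => invmx (G_Psi M) *m A M) (invmx (gram Psi) *m A0).
  by apply: mx_cvg_mul => //; exact: mx_cvg_inv.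
have K_cvg : mx_cvg K (invmx (gram Psi) *m A0).
  (* the minimiser is G_Psi^-1 A for large M, hence has the same limit *)
  move=> i j; apply: cvg_trans (edmd_cvg i j).
  apply: near_eq_cvg; near=> M.
  have uG : G_Psi M \in unitmx by near: M; exact: near_unitmx G_Psi_cvg uPsi.
  have lsqM : least_squares (w M) (data_matrix Psi (x M))
      (data_matrix Phi (F \o x M)) (K M) by near: M.
  by rewrite -(least_squares_solution (fun m => ltW (w_gt0 M m)) uG lsqM).
have proj_koopman c : proj_span Psi (koopman hF (synthesis Phi c)) =
    synthesis Psi (invmx (gram Psi) *m A0 *m c).
  by rewrite /proj_span koopman_synthesis analysis_synthesis mulmxA.
split.
- under eq_cvg do under eq_fun do rewrite proj_koopman.
  apply: (@operator_norm_synthesis_cvg0 _ _ _ _ _ _ 0 _ _ Psi idfun (fun=> 1)) => //.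
    by rewrite /euclidean_norm big1 ?sqrtr0// => i _; rewrite mxE expr0n.
  by move=> c j c1; exact: le_trans (entry_le_euclidean_norm _ _) c1.
- under eq_cvg do under eq_fun do rewrite proj_koopman mulmxA.
  apply: (@operator_norm_synthesis_cvg0 _ _ _ _ _ _ 0 _ _ Psi (analysis Phi)
    (fun j => L2norm (Phi j))).
  + by rewrite /norm L2norm0.
  + move=> g j g1; rewrite mxE; apply: le_trans (inner_cauchy_schwarz _ _) _.
    by rewrite ler_piMr// L2norm_ge0.
  + by apply: mx_cvg_mul => //; exact: mx_cvg_inv.
Unshelve. all: by end_near.
Qed.
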